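(* Let $W\in\mathbb{R}^{m\times n}$ be arbitrary and let $\{(\mathbf{u}^k,\mathbf{y}^k)\}$ be a bounded sequence generated by Algorithm B (described in the context). Define $$M:=\sup\Big\{\big\|((W^{\top})_{\mathcal{C}})^{\dagger}(-\nabla f(\mathbf{u}^k)-\beta W^{\top}W\mathbf{u}^k)\big\|_\infty\ :\ \mathcal{C}\subset[m],\ k=1,2,\dots\Big\}.$$ Suppose $\rho>\frac{mM^2}{\lambda}$ and that, for all sufficiently large $k$, no component $|(W\mathbf{u}^k)_i|$, $i\in[m]$, lies in the interval $$\Big(\frac{-M+\sqrt{M^2+\rho\lambda/m}}{\rho},\ \frac{M+\sqrt{M^2+2\rho(m+1)\lambda}}{\rho}\Big).$$ Let also $t=\max_k\{t_k\}$, $\rho\ge\max\{t,1\}$, and, with $\mathcal{C}^k=\{i\in[m]:y_i^k=0\}$ and some constant $c>0$, suppose that for all $k$ $$\begin{aligned}t_k\ge\max\Big\{\max_{j}\Big\{&4\Big[\|((W^{\top})_{\mathcal{C}^j})^{\dagger}\|\,\|W\|\,\|A^{\top}A+\beta W^{\top}W\|+\|W^{\top}W\|\,\|((W^{\top})_{\mathcal{C}^j})^{\dagger}\|^2\,\|A^{\top}A+\beta W^{\top}W\|\\&+\big(\|A^{\top}A+\beta W^{\top}W\|+1\big)\|((W^{\top})_{\mathcal{C}^j})^{\dagger}\|^2\,\|A^{\top}A+\beta W^{\top}W\|\Big]\Big\},\ c\Big\}.\end{aligned}$$ Then every accumulation point of $\{(\mathbf{u}^k,\mathbf{y}^k)\}$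 is a critical point of $h$.
   Context: Data: $A\in\mathbb{R}^{p\times n}$, $\mathbf{u}_0\in\mathbb{R}^p$, $f(\mathbf{u})=\frac12\|A\mathbf{u}-\mathbf{u}_0\|^2$, constants $\lambda,\beta,\rho>0$ and $t_k>0$. $[m]=\{1,\dots,m\}$; $\|\cdot\|$ is the Euclidean norm of vectors and the spectral norm of matrices, $\|\cdot\|_\infty$ the vector infinity norm, $\|\mathbf{y}\|_0$ the number of nonzero entries of $\mathbf{y}$; $\dagger$ denotes the Moore–Penrose pseudoinverse. For a matrix $B$ and index set $\mathcal{I}$, $B_{\mathcal{I}}$ is the submatrix of columns of $B$ indexed by $\mathcal{I}$; for a vector $\mathbf{y}$, $\mathbf{y}_{\mathcal{I}}$ is the corresponding subvector (for an empty index set the pseudoinverse norm is $0$). For $(\mathbf{u},\mathbf{y})\in\mathbb{R}^n\times\mathbb{R}^m$ put $\mathcal{C}=\{i\in[m]: y_i=0\}$, $\mathcal{I}=\{i\in[m]: y_i\ne0\}$ and define $\mathbf{z}(\mathbf{u},\mathbf{y})\in\mathbb{R}^m$ by $$(\mathbf{z}(\mathbf{u},\mathbf{y}))_{\mathcal{C}}=((W^{\top})_{\mathcal{C}})^{\dagger}(-\nabla f(\mathbf{u})-\beta W^{\top}W\mathbf{u}),\qquad (\mathbf{z}(\mathbf{u},\mathbf{y}))_{\mathcal{I}}=\mathbf{0}.$$ Define $$h(\mathbf{u},\mathbf{y})=f(\mathbf{u})+\langle W\mathbf{u}-\mathbf{y},\mathbf{z}(\mathbf{u},\mathbf{y})\rangle+\lambda\|\mathbf{y}\|_0+\tfrac{\beta}{2}\|W\mathbf{u}\|^2+\tfrac{\rho}{2}\|W\mathbf{u}-\mathbf{y}\|^2.$$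 Algorithm B: choose $\mathbf{u}^0\in\mathbb{R}^n$, set $\mathbf{y}^0=W\mathbf{u}^0$. For $k=0,1,2,\dots$: (1) $\mathbf{u}^{k+1}=\operatorname{argmin}_{\mathbf{u}\in\mathbb{R}^n}\{f(\mathbf{u})+\langle W\mathbf{u}-\mathbf{y}^k,\mathbf{z}(\mathbf{u}^k,\mathbf{y}^k)\rangle+\frac{\beta}{2}\|W\mathbf{u}\|^2+\frac{t_k}{2}\|\mathbf{u}-\mathbf{u}^k\|^2+\frac{\rho}{2}\|W\mathbf{u}-\mathbf{y}^k\|^2\}$; (2) $\mathbf{y}^{k+1}\in\operatorname{argmin}_{\mathbf{y}\in\mathbb{R}^m}h(\mathbf{u}^{k+1},\mathbf{y})$. Subdifferential: the regular subdifferential $\widehat\partial g(\mathbf{x})$ is the set of $\mathbf{v}$ with $\liminf_{\mathbf{x}'\to\mathbf{x},\,\mathbf{x}'\ne\mathbf{x}}\frac{g(\mathbf{x}')-g(\mathbf{x})-\langle\mathbf{v},\mathbf{x}'-\mathbf{x}\rangle}{\|\mathbf{x}'-\mathbf{x}\|}\ge0$; the (limiting) subdifferential $\partial g(\mathbf{x})$ is the set of $\mathbf{v}$ for which there are $\mathbf{x}^j\to\mathbf{x}$ with $g(\mathbf{x}^j)\to g(\mathbf{x})$ and $\mathbf{v}^j\in\widehat\partial g(\mathbf{x}^j)$ with $\mathbf{v}^j\to\mathbf{v}$. A critical point of $h$ is a point with $\mathbf{0}\in\partial h$. *)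

(* Defs.v *)
From HB Require Import structures.
From mathcomp Require Import all_boot all_order all_algebra.
From mathcomp Require Import all_classical all_reals all_analysis.
Set Implicit Arguments.
Unset Strict Implicit.
Unset Printing Implicit Defensive.
Import Order.TTheory GRing.Theory Num.Theory.
Import numFieldNormedType.Exports.
Local Open Scope classical_set_scope.
Local Open Scope ring_scope.

Definition dotv (R : realType) n (x y : 'cV[R]_n) : R :=
  \sum_(i < n) x i 0 * y i 0.

(* The library norm `|x| of a matrix is the entrywise maximum norm, hence the
   separate Euclidean norm here; on column vectors `|x| is the infinity norm. *)
Definition norm2 (R : realType) n (x : 'cV[R]_n) : R := Num.sqrt (dotv x x).

Definition spectral_norm (R : realType) m n (B : 'M[R]_(m, n)) : R :=
  sup [set norm2 (B *m x) | x in [set x : 'cV[R]_n | norm2 x <= 1]].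

Definition norm0 (R : realType) m (y : 'cV[R]_m) : nat :=
  #|[pred i : 'I_m | y i 0 != 0]|.

Definition grad (R : realType) n (g : 'cV[R]_n -> R) (x : 'cV[R]_n) :
    'cV[R]_n :=
  \col_(i < n) 'D_(delta_mx i 0) (g : 'cV[R]_n -> R^o) x.

Definition moore_penrose (R : realType) m n
    (B : 'M[R]_(m, n)) (X : 'M[R]_(n, m)) : Prop :=
  [/\ B *m X *m B = B, X *m B *m X = X,
      (B *m X)^T = B *m X & (X *m B)^T = X *m B].

Definition mp_pinv (R : realType) m n (B : 'M[R]_(m, n)) : 'M[R]_(n, m) :=
  xget 0 [set X | moore_penrose B X].

Lemma mulmx_tr_eq0 (R : realType) m n (B : 'M[R]_(m, n)) :
  B *m B^T = 0 -> B = 0.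
Proof.
move=> B0; apply/matrixP => i j; rewrite mxE.
have /eqP := congr1 (fun X : 'M[R]_m => X i i) B0.
rewrite !mxE psumr_eq0 => [|k _]; last by rewrite mxE -expr2 sqr_ge0.
move=> /allP/(_ j); rewrite mem_index_enum mxE mulf_eq0 orbb => /(_ isT).
by move/eqP.
Qed.

Lemma row_free_gram (R : realType) m n (B : 'M[R]_(m, n)) :
  row_free B -> B *m B^T \in unitmx.
Proof.
move=> Bfree; rewrite -row_free_unit -kermx_eq0; apply/eqP.
set K := kermx _; have KB : K *m (B *m B^T) = 0 by exact: mulmx_ker.
apply/(row_free_inj Bfree); rewrite mul0mx; apply: mulmx_tr_eq0.
by rewrite trmx_mul -[LHS]mulmxA (mulmxA B) mulmxA KB mul0mx.
Qed.

Lemma moore_penrose_unique (R : realType) m n (B : 'M[R]_(m, n)) X Y :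
  moore_penrose B X -> moore_penrose B Y -> X = Y.
Proof.
case=> X1 X2 X3 X4 [Y1 Y2 Y3 Y4].
have BXY : B *m X = B *m Y.
  by rewrite -X3 -{1}Y1 -[B *m Y *m B *m X]mulmxA trmx_mul X3 Y3 mulmxA X1.
have XYB : X *m B = Y *m B.
  by rewrite -X4 -{1}Y1 -mulmxA mulmxA trmx_mul X4 Y4 -!mulmxA (mulmxA B X) X1.
by rewrite -X2 XYB -mulmxA BXY mulmxA.
Qed.

Lemma mp_pinvP (R : realType) m n (B : 'M[R]_(m, n)) : moore_penrose B (mp_pinv B).
Proof.
rewrite /mp_pinv; case: xgetP => [X _ //|/(_ _) noX]; exfalso.
have: exists r (C : 'M[R]_(m, r)) (F : 'M[R]_(r, n)),
    [/\ C *m F = B, row_full C & row_free F].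
  by exists (\rank B), (col_base B), (row_base B); rewrite mulmx_base
    col_base_full row_base_free.
case=> r [C [F [CF Cfull Ffree]]].
have uF : F *m F^T \in unitmx by exact: row_free_gram.
have uC : C^T *m C \in unitmx.
  rewrite -{2}[C]trmxK; apply: row_free_gram.
  by rewrite /row_free mxrank_tr.
pose iF := invmx (F *m F^T); pose iC := invmx (C^T *m C).
pose X := F^T *m iF *m (iC *m C^T).
have BX : B *m X = C *m iC *m C^T.
  by rewrite -CF /X -!mulmxA (mulmxA F) (mulmxA (F *m F^T)) mulmxV // mul1mx.
have XB : X *m B = F^T *m iF *m F.
  by rewrite -CF /X -!mulmxA (mulmxA C^T) (mulmxA iC) mulVmx // mul1mx.
have iCT : iC^T = iC by rewrite /iC trmx_inv trmx_mul trmxK.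
have iFT : iF^T = iF by rewrite /iF trmx_inv trmx_mul trmxK.
apply: (noX X); split.
- by rewrite BX -CF -!mulmxA (mulmxA C^T) (mulmxA iC) mulVmx // mul1mx.
- by rewrite XB /X -!mulmxA (mulmxA F) (mulmxA (F *m F^T)) mulmxV // mul1mx.
- by rewrite BX !trmx_mul trmxK iCT mulmxA.
- by rewrite XB !trmx_mul trmxK iFT mulmxA.
Qed.

Definition cols (R : realType) m n (C : {set 'I_n}) (B : 'M[R]_(m, n)) :
    'M[R]_(m, #|C|) :=
  colsub (fun j : 'I_#|C| => enum_val j) B.

Definition zero_set (R : realType) m (y : 'cV[R]_m) : {set 'I_m} :=
  [set i | y i 0 == 0].

Definition f (R : realType) p n (A : 'M[R]_(p, n)) (u0 : 'cV[R]_p)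
    (u : 'cV[R]_n) : R :=
  2^-1 * norm2 (A *m u - u0) ^+ 2.

Definition zC (R : realType) p n m (A : 'M[R]_(p, n)) (u0 : 'cV[R]_p)
    (W : 'M[R]_(m, n)) (beta : R) (C : {set 'I_m}) (u : 'cV[R]_n) :
    'cV[R]_#|C| :=
  mp_pinv (cols C W^T) *m (- grad (f A u0) u - beta *: (W^T *m W *m u)).

(* The sum has exactly one term if i \in C, and none otherwise. *)
Definition extend0 (R : realType) m (C : {set 'I_m}) (v : 'cV[R]_#|C|) :
    'cV[R]_m :=
  \col_(i < m) \sum_(j < #|C| | enum_val j == i) v j 0.

Definition z (R : realType) p n m (A : 'M[R]_(p, n)) (u0 : 'cV[R]_p)
    (W : 'M[R]_(m, n)) (beta : R) (u : 'cV[R]_n) (y : 'cV[R]_m) : 'cV[R]_m :=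
  extend0 (zC A u0 W beta (zero_set y) u).

Definition h (R : realType) p n m (A : 'M[R]_(p, n)) (u0 : 'cV[R]_p)
    (W : 'M[R]_(m, n)) (lambda beta rho : R)
    (u : 'cV[R]_n) (y : 'cV[R]_m) : R :=
  f A u0 u + dotv (W *m u - y) (z A u0 W beta u y) + lambda * (norm0 y)%:R
  + beta / 2 * norm2 (W *m u) ^+ 2 + rho / 2 * norm2 (W *m u - y) ^+ 2.

Definition is_argmin (R : realType) T (F : T -> R) (x : T) : Prop :=
  forall x' : T, F x <= F x'.

Definition ustep_obj (R : realType) p n m (A : 'M[R]_(p, n)) (u0 : 'cV[R]_p)
    (W : 'M[R]_(m, n)) (beta rho tk : R) (uk : 'cV[R]_n) (yk : 'cV[R]_m)
    (v : 'cV[R]_n) : R :=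
  f A u0 v + dotv (W *m v - yk) (z A u0 W beta uk yk)
  + beta / 2 * norm2 (W *m v) ^+ 2 + tk / 2 * norm2 (v - uk) ^+ 2
  + rho / 2 * norm2 (W *m v - yk) ^+ 2.

(* For tk > 0 the u-objective is strongly convex, so that its minimizer is
   unique and the equality u^{k+1} = argmin amounts to membership. *)
Definition algorithmB (R : realType) p n m (A : 'M[R]_(p, n)) (u0 : 'cV[R]_p)
    (W : 'M[R]_(m, n)) (lambda beta rho : R) (tk : nat -> R)
    (u : nat -> 'cV[R]_n) (y : nat -> 'cV[R]_m) : Prop :=
  [/\ y 0%N = W *m u 0%N,
      forall k, is_argmin (ustep_obj A u0 W beta rho (tk k) (u k) (y k)) (u k.+1)
    & forall k, is_argmin (h A u0 W lambda beta rho (u k.+1)) (y k.+1)].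

Definition Mconst (R : realType) p n m (A : 'M[R]_(p, n)) (u0 : 'cV[R]_p)
    (W : 'M[R]_(m, n)) (beta : R) (u : nat -> 'cV[R]_n) : R :=
  sup [set `|zC A u0 W beta C (u k)| |
       C in [set: {set 'I_m}] & k in [set k | (1 <= k)%N]].

Definition tbound (R : realType) p n m (A : 'M[R]_(p, n)) (W : 'M[R]_(m, n))
    (beta : R) (C : {set 'I_m}) : R :=
  let P := spectral_norm (mp_pinv (cols C W^T)) in
  let H := spectral_norm (A^T *m A + beta *: (W^T *m W)) in
  4 * (P * spectral_norm W * H + spectral_norm (W^T *m W) * P ^+ 2 * H
       + (H + 1) * P ^+ 2 * H).

Definition regular_subdiff (R : realType) N (g : 'cV[R]_N -> R)
    (x : 'cV[R]_N) : set 'cV[R]_N :=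
  [set v | (0 <= limf_einf
     (fun x' => ((g x' - g x - dotv v (x' - x)) / norm2 (x' - x))%:E) x^')%E].

Definition subdiff (R : realType) N (g : 'cV[R]_N -> R) (x : 'cV[R]_N) :
    set 'cV[R]_N :=
  [set v | exists xs vs : nat -> 'cV[R]_N,
     [/\ xs j @[j --> \oo] --> x, g (xs j) @[j --> \oo] --> g x,
         forall j, regular_subdiff g (xs j) (vs j)
       & vs j @[j --> \oo] --> v]].

Definition critical_point (R : realType) N (g : 'cV[R]_N -> R)
    (x : 'cV[R]_N) : Prop :=
  subdiff g x 0.

(* R^n x R^m is identified with R^(n + m) through col_mx. *)
Definition hjoint (R : realType) p n m (A : 'M[R]_(p, n)) (u0 : 'cV[R]_p)
    (W : 'M[R]_(m, n)) (lambda beta rho : R) (x : 'cV[R]_(n + m)) : R :=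
  h A u0 W lambda beta rho (usubmx x) (dsubmx x).

(* Main.v *)
(* Where y vanishes the y-step costs at most a quantity controlled by M, so the
   gap condition on |W u^k| forces every nonzero entry of y^k to equal the
   entry of W u^k and to stay above a positive threshold. Stationarity of the
   u-step, multiplied by the pseudoinverse of B = (W^T)_C, expresses the rows
   of W u^{k+1} indexed by C through u^{k+1} - u^k; this bounds the drift of the
   multiplier z quadratically, so that h decreases by at least
   (c/4) |u^{k+1} - u^k|^2 at each step and the increments tend to 0. At an
   accumulation point (u, y) one gets W u = y and B B^+ g = g with
   g = - grad f(u) - beta W^T W u, and then 0 is already a regular subgradient. *)
Require Import Defs.
From HB Require Import structures.
From mathcomp Require Import all_boot all_order all_algebra.
From mathcomp Require Import all_classical all_reals all_analysis.
From mathcomp Require Import ring lra.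
Set Implicit Arguments.
Unset Strict Implicit.
Unset Printing Implicit Defensive.
Import Order.TTheory GRing.Theory Num.Theory.
Import numFieldNormedType.Exports.
Local Open Scope classical_set_scope.
Local Open Scope ring_scope.

(** * Euclidean and spectral norms *)

Lemma dotvE (R : realType) n (x y : 'cV[R]_n) : dotv x y = (x^T *m y) 0 0.
Proof. by rewrite mxE; apply: eq_bigr => i _; rewrite mxE. Qed.

Lemma dotvC (R : realType) n (x y : 'cV[R]_n) : dotv x y = dotv y x.
Proof. by apply: eq_bigr => i _; rewrite mulrC. Qed.

Lemma dotvDl (R : realType) n (x y v : 'cV[R]_n) :
  dotv (x + y) v = dotv x v + dotv y v.
Proof. by rewrite !dotvE linearD mulmxDl mxE. Qed.

Lemma dotvZl (R : realType) n a (x v : 'cV[R]_n) :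
  dotv (a *: x) v = a * dotv x v.
Proof. by rewrite !dotvE linearZ -scalemxAl mxE. Qed.

Lemma dotvNl (R : realType) n (x v : 'cV[R]_n) : dotv (- x) v = - dotv x v.
Proof. by rewrite -scaleN1r dotvZl mulN1r. Qed.

Lemma dotvDr (R : realType) n (x y v : 'cV[R]_n) :
  dotv v (x + y) = dotv v x + dotv v y.
Proof. by rewrite dotvC dotvDl !(dotvC v). Qed.

Lemma dotvZr (R : realType) n a (x v : 'cV[R]_n) :
  dotv v (a *: x) = a * dotv v x.
Proof. by rewrite dotvC dotvZl dotvC. Qed.

Lemma dotvNr (R : realType) n (x v : 'cV[R]_n) : dotv v (- x) = - dotv v x.
Proof. by rewrite dotvC dotvNl dotvC. Qed.

Definition dotv_lin := (dotvDl, dotvDr, dotvNl, dotvNr, dotvZl, dotvZr).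

Lemma dotv_mull (R : realType) m n (B : 'M[R]_(m, n)) x y :
  dotv (B *m x) y = dotv x (B^T *m y).
Proof. by rewrite !dotvE trmx_mul mulmxA. Qed.

Lemma dotvv_ge0 (R : realType) n (x : 'cV[R]_n) : 0 <= dotv x x.
Proof. by apply: sumr_ge0 => i _; rewrite -expr2 sqr_ge0. Qed.

Lemma norm2_ge0 (R : realType) n (x : 'cV[R]_n) : 0 <= norm2 x.
Proof. exact: sqrtr_ge0. Qed.

Lemma norm2_sqr (R : realType) n (x : 'cV[R]_n) : norm2 x ^+ 2 = dotv x x.
Proof. by rewrite sqr_sqrtr ?dotvv_ge0. Qed.

Lemma norm2_0 (R : realType) n : norm2 (0 : 'cV[R]_n) = 0.
Proof. by rewrite /norm2 /dotv big1 ?sqrtr0// => i _; rewrite mxE mul0r. Qed.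

Lemma coord_le_norm2 (R : realType) n (x : 'cV[R]_n) i : `|x i 0| <= norm2 x.
Proof.
rewrite -sqrtr_sqr ler_wsqrtr// /dotv (bigD1 i)//= -expr2 lerDl.
by apply: sumr_ge0 => j _; rewrite -expr2 sqr_ge0.
Qed.

Lemma norm2_le0 (R : realType) n (x : 'cV[R]_n) : norm2 x <= 0 -> x = 0.
Proof.
move=> x0; apply/matrixP => i j; rewrite (ord1 j) [RHS]mxE; apply/eqP.
by rewrite -normr_le0 (le_trans (coord_le_norm2 x i)).
Qed.

(** Cauchy-Schwarz: the squared norm of [dotv y y *: x - dotv x y *: y] equals |y|^2 (|x|^2 |y|^2 -
    <x,y>^2). *)
Lemma dotv_le (R : realType) n (x y : 'cV[R]_n) :
  `|dotv x y| <= norm2 x * norm2 y.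
Proof.
have [/norm2_le0->|y0] := lerP (norm2 y) 0.
  by rewrite norm2_0 mulr0 /dotv big1 ?normr0// => i _; rewrite mxE mulr0.
rewrite -ler_sqr ?nnegrE ?mulr_ge0 ?norm2_ge0// real_normK ?num_real//.
rewrite exprMn !norm2_sqr.
have b0 : 0 < dotv y y by rewrite -norm2_sqr exprn_gt0.
have := dotvv_ge0 (dotv y y *: x - dotv x y *: y).
rewrite !dotv_lin (dotvC y x) => le0.
have : 0 <= dotv y y * (dotv x x * dotv y y - dotv x y ^+ 2) by nra.
by rewrite pmulr_rge0// subr_ge0.
Qed.

Lemma norm2D (R : realType) n (x y : 'cV[R]_n) :
  norm2 (x + y) <= norm2 x + norm2 y.
Proof.
rewrite -ler_sqr ?nnegrE ?addr_ge0 ?norm2_ge0// sqrrD !norm2_sqr !dotv_lin.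
rewrite (dotvC y x) mulr2n.
have := le_trans (ler_norm _) (dotv_le x y); lra.
Qed.

Lemma norm2Z (R : realType) n a (x : 'cV[R]_n) : norm2 (a *: x) = `|a| * norm2 x.
Proof.
by rewrite /norm2 !dotv_lin mulrA -expr2 sqrtrM ?sqr_ge0// sqrtr_sqr.
Qed.

Lemma norm2N (R : realType) n (x : 'cV[R]_n) : norm2 (- x) = norm2 x.
Proof. by rewrite -scaleN1r norm2Z normrN1 mul1r. Qed.

Lemma norm2B (R : realType) n (x y : 'cV[R]_n) :
  norm2 (x - y) <= norm2 x + norm2 y.
Proof. by rewrite -(norm2N y) norm2D. Qed.

Lemma mxnorm_le_norm2 (R : realType) n (x : 'cV[R]_n) : `|x| <= norm2 x.
Proof.
rewrite [`|x|]mx_normrE; apply/bigmax_leP; split; first exact: norm2_ge0.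
by move=> [i j] _ /=; rewrite (ord1 j) coord_le_norm2.
Qed.

Lemma coord_le_mxnorm (R : realType) n (x : 'cV[R]_n) i : `|x i 0| <= `|x|.
Proof.
rewrite [`|x|]mx_normrE.
by apply/bigmax_geP; right; exists (i, 0).
Qed.

Lemma norm2_le_mxnorm (R : realType) n (x : 'cV[R]_n) :
  norm2 x <= n%:R * `|x|.
Proof.
rewrite -ler_sqr ?nnegrE ?mulr_ge0 ?norm2_ge0// norm2_sqr exprMn.
have -> : n%:R ^+ 2 * `|x| ^+ 2 = \sum_(i < n) n%:R * `|x| ^+ 2 :> R.
  by rewrite sumr_const card_ord -mulr_natl; ring.
rewrite /dotv; apply: ler_sum => i _; rewrite -expr2 -real_normK ?num_real//.
(* The index [i] witnesses that the dimension is positive. *)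
have n1 : 1 <= n%:R :> R by rewrite ler1n (leq_ltn_trans _ (ltn_ord i)).
rewrite -[leLHS]mul1r ler_pM ?exprn_ge0//.
by rewrite lerXn2r ?nnegrE// coord_le_mxnorm.
Qed.

(** A crude row-by-row constant; it serves only to show that the supremum in [spectral_norm] is
    finite. *)
Lemma mulmx_bounded (R : realType) m n (B : 'M[R]_(m, n)) :
  exists K, 0 <= K /\ forall x, norm2 (B *m x) <= K * norm2 x.
Proof.
pose K := \sum_i norm2 (row i B)^T; have K0 : 0 <= K.
  by apply: sumr_ge0 => i _; exact: norm2_ge0.
exists (m%:R * K); split=> [|x]; first by rewrite mulr_ge0.
apply: (le_trans (norm2_le_mxnorm _)); rewrite -mulrA ler_wpM2l//.
rewrite [`|_|]mx_normrE; apply/bigmax_leP.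
split=> [|[i j] _ /=]; first by rewrite mulr_ge0 ?norm2_ge0.
have -> : (B *m x) i j = dotv (row i B)^T x.
  by rewrite (ord1 j) dotvE trmxK -row_mul [RHS]mxE.
apply: (le_trans (dotv_le _ _)); rewrite ler_wpM2r ?norm2_ge0//.
by rewrite /K (bigD1 i)//= lerDl sumr_ge0// => k _; exact: norm2_ge0.
Qed.

Lemma has_sup_spectral_norm (R : realType) m n (B : 'M[R]_(m, n)) :
  has_sup [set norm2 (B *m x) | x in [set x : 'cV[R]_n | norm2 x <= 1]].
Proof.
split; first by exists (norm2 (B *m 0)), 0 => //=; rewrite norm2_0 ler01.
have [K [K0 BK]] := mulmx_bounded B; exists K => _ [x /= x1 <-].
by rewrite (le_trans (BK x))// ler_piMr.
Qed.

Lemma spectral_norm_ge0 (R : realType) m n (B : 'M[R]_(m, n)) :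
  0 <= spectral_norm B.
Proof.
apply: ub_le_sup; first by case: (has_sup_spectral_norm B).
by exists 0 => /=; rewrite ?mulmx0 norm2_0.
Qed.

Lemma norm2_mulmx (R : realType) m n (B : 'M[R]_(m, n)) x :
  norm2 (B *m x) <= spectral_norm B * norm2 x.
Proof.
have [/norm2_le0->|x0] := lerP (norm2 x) 0.
  by rewrite mulmx0 !norm2_0 mulr0.
rewrite -ler_pdivrMr//; apply: ub_le_sup.
  by case: (has_sup_spectral_norm B).
exists ((norm2 x)^-1 *: x) => /=.
  by rewrite norm2Z ger0_norm ?invr_ge0 ?norm2_ge0// mulVf// gt_eqF.
by rewrite -scalemxAr norm2Z ger0_norm ?invr_ge0 ?norm2_ge0// mulrC.
Qed.

(** * The quadratic energy and the multiplier matrix *)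

Lemma dotv_tmull (R : realType) m n (B : 'M[R]_(m, n)) x y :
  dotv (B^T *m x) y = dotv x (B *m y).
Proof. by rewrite dotv_mull trmxK. Qed.

(** First-order condition without a sign on b: the step s = -a/(|b|+1) makes the polynomial negative
    unless a = 0. The added 1 keeps the denominator positive. *)
Lemma quadratic_min_eq0 (R : realType) (a b : R) :
  (forall s, 0 <= s * a + s ^+ 2 * b) -> a = 0.
Proof.
move=> ab; have [//|a0] := eqVneq a 0; exfalso.
have b0 := normr_ge0 b; have bb := ler_norm b.
have B0 : 0 < `|b| + 1 by lra.
have := ab (- a / (`|b| + 1)).
have -> : - a / (`|b| + 1) * a + (- a / (`|b| + 1)) ^+ 2 * b =
    (a / (`|b| + 1)) ^+ 2 * (b - (`|b| + 1)).
  by field; rewrite gt_eqF.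
rewrite pmulr_rge0; first by lra.
by rewrite exprn_even_gt0//= mulf_neq0// invr_neq0// gt_eqF.
Qed.

Definition hess (R : realType) p n m (A : 'M[R]_(p, n)) (W : 'M[R]_(m, n))
    (beta : R) : 'M[R]_n := A^T *m A + beta *: (W^T *m W).

(** Minus the gradient of [energy] in affine form; this is the vector to which [zC] applies the
    pseudoinverse. *)
Definition negrad (R : realType) p n m (A : 'M[R]_(p, n)) (u0 : 'cV[R]_p)
    (W : 'M[R]_(m, n)) (beta : R) (u : 'cV[R]_n) : 'cV[R]_n :=
  A^T *m u0 - hess A W beta *m u.

Definition energy (R : realType) p n m (A : 'M[R]_(p, n)) (u0 : 'cV[R]_p)
    (W : 'M[R]_(m, n)) (beta : R) (u : 'cV[R]_n) : R :=
  f A u0 u + beta / 2 * norm2 (W *m u) ^+ 2.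

(** The second-order Taylor expansion of a quadratic is exact. *)
Lemma fD (R : realType) p n (A : 'M[R]_(p, n)) u0 u d :
  f A u0 (u + d) = f A u0 u + dotv (A^T *m (A *m u - u0)) d
                   + 2^-1 * dotv (A *m d) (A *m d).
Proof.
rewrite /f !norm2_sqr dotv_tmull mulmxDr !dotv_lin.
rewrite !(dotvC u0) !(dotvC (A *m d) (A *m u)); lra.
Qed.

Lemma grad_f (R : realType) p n (A : 'M[R]_(p, n)) u0 u :
  grad (f A u0) u = A^T *m (A *m u - u0).
Proof.
apply/matrixP => i j; rewrite (ord1 j) mxE /derive.
set g := A^T *m _; set d := delta_mx i 0.
have gi : dotv g d = g i 0.
  rewrite /dotv (bigD1 i)//= [d i 0]mxE !eqxx mulr1 big1 ?addr0// => k ki.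
  by rewrite [d k 0]mxE (negPf ki) mulr0.
apply: cvg_lim => //; rewrite -gi.
(* For s <> 0 the difference quotient is exactly [dotv g d + s * q]. *)
pose q : R := 2^-1 * dotv (A *m d) (A *m d).
have q0 : (fun s : R => dotv g d + s * q) @ 0^' --> dotv g d.
  rewrite -[X in _ --> X]addr0 -[X in _ --> _ + X](mul0r q).
  apply: cvgD; first exact: cvg_cst.
  by apply: cvgMl; exact: cvg_within.
apply: cvg_trans q0; apply: near_eq_cvg; near=> s.
have s0 : s != 0 by near: s; exact: nbhs_dnbhs_neq.
rewrite /= [s *: d + u]addrC fD -/g -scalemxAr !dotv_lin.
rewrite -/q [RHS]/GRing.scale/= /q; field.
Unshelve. all: by end_near. Qed.

Lemma energyD (R : realType) p n m (A : 'M[R]_(p, n)) u0 (W : 'M[R]_(m, n)) beta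
    u d :
  energy A u0 W beta (u + d) = energy A u0 W beta u
    - dotv (negrad A u0 W beta u) d
    + 2^-1 * (dotv (A *m d) (A *m d) + beta * dotv (W *m d) (W *m d)).
Proof.
rewrite /energy fD /negrad /hess !norm2_sqr mulmxDl -scalemxAl.
rewrite -!mulmxA mulmxDr mulmxDr mulmxN !dotv_lin !dotv_tmull.
rewrite (dotvC (W *m d) (W *m u)); lra.
Qed.

(** * Coordinate selection and the multiplier as a matrix *)

Definition sel (R : realType) m (C : {set 'I_m}) : 'M[R]_(m, #|C|) :=
  cols C 1%:M.

(** With B = [cols C W^T], the product [W^T *m multmx W C] is B B^+, the orthogonal projector onto
    the column space of B. *)
Definition multmx (R : realType) n m (W : 'M[R]_(m, n)) (C : {set 'I_m}) :
    'M[R]_(m, n) := sel R C *m mp_pinv (cols C W^T).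

Lemma colsE (R : realType) m n (C : {set 'I_n}) (B : 'M[R]_(m, n)) :
  cols C B = B *m sel R C.
Proof. by rewrite /sel /cols mulmx_colsub mulmx1. Qed.

Lemma extend0E (R : realType) m (C : {set 'I_m}) (v : 'cV[R]_#|C|) :
  extend0 v = sel R C *m v.
Proof.
apply/matrixP => i j; rewrite (ord1 j) !mxE big_mkcond; apply: eq_bigr => k _.
by rewrite !mxE eq_sym; case: eqVneq => _; rewrite ?mul1r ?mul0r.
Qed.

Lemma sel_mulmx_notin (R : realType) m (C : {set 'I_m}) (v : 'cV[R]_#|C|) i :
  i \notin C -> (sel R C *m v) i 0 = 0.
Proof.
move=> iC; rewrite -extend0E mxE big1// => j /eqP ji.
by move: iC; rewrite -ji enum_valP.
Qed.

Lemma sel_mulmx_in (R : realType) m (C : {set 'I_m}) (v : 'cV[R]_#|C|) i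
  (iC : i \in C) : (sel R C *m v) i 0 = v (enum_rank_in iC i) 0.
Proof.
rewrite -extend0E mxE (big_pred1 (enum_rank_in iC i))// => j /=.
by rewrite -{1}(enum_rankK_in iC iC) (inj_eq enum_val_inj).
Qed.

Lemma sel_tr_mulmx (R : realType) m (C : {set 'I_m}) (x : 'cV[R]_m) j :
  ((sel R C)^T *m x) j 0 = x (enum_val j) 0.
Proof.
rewrite mxE (bigD1 (enum_val j))//= !mxE eqxx mul1r big1 ?addr0// => k kj.
by rewrite !mxE (negPf kj) mul0r.
Qed.

Lemma sel_selT (R : realType) m (C : {set 'I_m}) (x : 'cV[R]_m) i :
  (sel R C *m ((sel R C)^T *m x)) i 0 = if i \in C then x i 0 else 0.
Proof.
case: (boolP (i \in C)) => iC; last by rewrite sel_mulmx_notin.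
by rewrite sel_mulmx_in sel_tr_mulmx enum_rankK_in.
Qed.

Lemma multmx_le (R : realType) n m (W : 'M[R]_(m, n)) (C : {set 'I_m})
    (v : 'cV[R]_n) i :
  `|(multmx W C *m v) i 0| <= `|mp_pinv (cols C W^T) *m v|.
Proof.
rewrite /multmx -mulmxA; case: (boolP (i \in C)) => iC.
  by rewrite sel_mulmx_in coord_le_mxnorm.
by rewrite sel_mulmx_notin// normr0.
Qed.

Lemma multmx_notin (R : realType) n m (W : 'M[R]_(m, n)) (C : {set 'I_m})
    (v : 'cV[R]_n) i :
  i \notin C -> (multmx W C *m v) i 0 = 0.
Proof. by move=> iC; rewrite /multmx -mulmxA sel_mulmx_notin. Qed.

Lemma zCE (R : realType) p n m (A : 'M[R]_(p, n)) u0 (W : 'M[R]_(m, n)) beta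
    C u :
  zC A u0 W beta C u = mp_pinv (cols C W^T) *m negrad A u0 W beta u.
Proof.
rewrite /zC grad_f /negrad /hess; congr (_ *m _).
by rewrite mulmxBr mulmxDl -scalemxAl mulmxA opprB opprD addrA.
Qed.

Lemma zE (R : realType) p n m (A : 'M[R]_(p, n)) u0 (W : 'M[R]_(m, n)) beta
    u y :
  z A u0 W beta u y = multmx W (zero_set y) *m negrad A u0 W beta u.
Proof. by rewrite /z extend0E zCE /multmx mulmxA. Qed.

(** The multiplier is supported on the zero set of y, so <y, z> drops out of [h]. *)
Lemma dotv_zero_set (R : realType) n m (W : 'M[R]_(m, n)) (y : 'cV[R]_m)
    (v : 'cV[R]_n) :
  dotv y (multmx W (zero_set y) *m v) = 0.
Proof.
rewrite /dotv big1// => i _; have [->|yi] := eqVneq (y i 0) 0.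
  by rewrite mul0r.
by rewrite multmx_notin ?mulr0// inE.
Qed.

Lemma hE (R : realType) p n m (A : 'M[R]_(p, n)) u0 (W : 'M[R]_(m, n))
    lambda beta rho u y :
  h A u0 W lambda beta rho u y = energy A u0 W beta u
    + dotv (W *m u) (z A u0 W beta u y) + lambda * (norm0 y)%:R
    + rho / 2 * norm2 (W *m u - y) ^+ 2.
Proof.
rewrite /h /energy dotvDl dotvNl zE dotv_zero_set subr0; ring.
Qed.

(** * The u-step *)

Lemma norm2_sqrD (R : realType) n (x y : 'cV[R]_n) :
  norm2 (x + y) ^+ 2 = norm2 x ^+ 2 + 2 * dotv x y + norm2 y ^+ 2.
Proof. rewrite !norm2_sqr !dotv_lin (dotvC y x); ring. Qed.

Lemma norm2_le_coord (R : realType) n (x y : 'cV[R]_n) :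
  (forall i, `|x i 0| <= `|y i 0|) -> norm2 x <= norm2 y.
Proof.
move=> xy; apply: ler_wsqrtr; apply: ler_sum => i _; rewrite -!expr2.
by rewrite -real_normK ?num_real// -[leRHS]real_normK ?num_real// lerXn2r ?nnegrE.
Qed.

Lemma norm2_mulmx_sqr (R : realType) m n (W : 'M[R]_(m, n)) x :
  norm2 (W *m x) ^+ 2 <= spectral_norm (W^T *m W) * norm2 x ^+ 2.
Proof.
rewrite norm2_sqr dotv_mull mulmxA.
apply: (le_trans (ler_norm _)); apply: (le_trans (dotv_le _ _)).
by rewrite expr2 mulrCA ler_wpM2l ?norm2_ge0// norm2_mulmx.
Qed.

(** With v = W^T y, |v|^2 = <y, W v> <= |W x| |W v|, and both factors are controlled by |W^T W|.
    This yields the constant that occurs in [tbound]. *)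
Lemma norm2_tr_mulmx_le (R : realType) m n (W : 'M[R]_(m, n)) x y :
  norm2 y <= norm2 (W *m x) ->
  norm2 (W^T *m y) <= spectral_norm (W^T *m W) * norm2 x.
Proof.
move=> yx; set v := W^T *m y; set K := spectral_norm _.
have K0 : 0 <= K by exact: spectral_norm_ge0.
have [v0|v0] := lerP (norm2 v) 0.
  by rewrite (le_trans v0)// mulr_ge0 ?norm2_ge0.
have vv : norm2 v ^+ 2 <= norm2 (W *m x) * norm2 (W *m v).
  rewrite norm2_sqr {1}/v dotv_tmull.
  apply: (le_trans (ler_norm _)); apply: (le_trans (dotv_le _ _)).
  by rewrite ler_wpM2r ?norm2_ge0.
(* Squaring makes [norm2_mulmx_sqr] applicable to both factors; |v|^2 is then cancelled. *)
have : (norm2 v ^+ 2) ^+ 2 <= (K * norm2 x ^+ 2) * (K * norm2 v ^+ 2).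
  apply: (@le_trans _ _ ((norm2 (W *m x) * norm2 (W *m v)) ^+ 2)).
    by rewrite lerXn2r ?nnegrE ?exprn_ge0 ?mulr_ge0 ?norm2_ge0.
  by rewrite exprMn ler_pM ?exprn_ge0 ?norm2_ge0// norm2_mulmx_sqr.
have -> : (K * norm2 x ^+ 2) * (K * norm2 v ^+ 2) =
    (K * norm2 x) ^+ 2 * norm2 v ^+ 2 by ring.
rewrite [X in X <= _]expr2 ler_pM2r ?exprn_gt0//.
by rewrite ler_pXn2r ?nnegrE ?mulr_ge0 ?norm2_ge0.
Qed.

Lemma ustep_objE (R : realType) p n m (A : 'M[R]_(p, n)) u0 (W : 'M[R]_(m, n))
    beta rho tk u y v :
  ustep_obj A u0 W beta rho tk u y v = energy A u0 W beta v
    + dotv (W *m v - y) (z A u0 W beta u y) + tk / 2 * norm2 (v - u) ^+ 2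
    + rho / 2 * norm2 (W *m v - y) ^+ 2.
Proof. rewrite /ustep_obj /energy; ring. Qed.

(** The objective is tested along its own gradient g at v: it changes by s <g,g> + s^2 q, so <g,g> =
    0. *)
Lemma ustep_stationary (R : realType) p n m (A : 'M[R]_(p, n)) u0
    (W : 'M[R]_(m, n)) beta rho tk u y v :
  is_argmin (ustep_obj A u0 W beta rho tk u y) v ->
  - negrad A u0 W beta v + W^T *m z A u0 W beta u y + tk *: (v - u)
    + rho *: (W^T *m (W *m v - y)) = 0.
Proof.
move=> vmin; set g := (X in X = 0).
apply: norm2_le0; suff g0 : dotv g g = 0 by rewrite /norm2 g0 sqrtr0.
pose q := 2^-1 * (dotv (A *m g) (A *m g) + beta * dotv (W *m g) (W *m g)
  + tk * dotv g g + rho * dotv (W *m g) (W *m g)).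
apply: (@quadratic_min_eq0 _ _ q) => s.
have := vmin (v + s *: g); rewrite !ustep_objE energyD.
have -> : W *m (v + s *: g) - y = (W *m v - y) + s *: (W *m g).
  by rewrite mulmxDr -scalemxAr addrAC.
have -> : v + s *: g - u = (v - u) + s *: g by rewrite addrAC.
rewrite !norm2_sqrD !norm2_sqr -!scalemxAr.
have gE d : dotv g d = - dotv (negrad A u0 W beta v) d
    + dotv (W *m d) (z A u0 W beta u y) + tk * dotv (v - u) d
    + rho * dotv (W *m v - y) (W *m d).
  rewrite /g (dotvDl _ (rho *: _)) (dotvDl _ (tk *: _)) (dotvDl (- _)).
  by rewrite !dotvZl (dotvNl (negrad _ _ _ _ _)) !dotv_tmull
    (dotvC (z _ _ _ _ _ _)).
rewrite {1}gE /q !(dotvDl _ (s *: _)) !dotvZl !dotvZr; lra.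
Qed.

(** * Residual and descent of the u-step *)

Lemma addmxE (R : realType) m n (x y : 'M[R]_(m, n)) i j :
  (x + y) i j = x i j + y i j.
Proof. by rewrite mxE. Qed.

Lemma submxE (R : realType) m n (x y : 'M[R]_(m, n)) i j :
  (x - y) i j = x i j - y i j.
Proof. by rewrite addmxE [(- y) i j]mxE. Qed.

(** Where y vanishes the residual is W v itself; elsewhere y = W u and it is W (v - u). *)
Lemma ustep_residual (R : realType) n m (W : 'M[R]_(m, n)) u v (y : 'cV[R]_m) :
  (forall i, y i 0 != 0 -> y i 0 = (W *m u) i 0) ->
  let S := sel R (zero_set y) in let d := W *m (v - u) in
  W *m v - y = S *m (S^T *m (W *m v)) + (d - S *m (S^T *m d)).
Proof.
move=> yw S d; apply/matrixP => i j; rewrite (ord1 j) [RHS]addmxE !submxE.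
rewrite !sel_selT inE /d mulmxBr submxE.
by have [->|/yw ->] := eqVneq (y i 0) 0; ring.
Qed.

(** As B^+ B is symmetric, B^+ B B^T is the transpose of B B^+ B = B. *)
Lemma mp_pinv_mul_gram (R : realType) m n (B : 'M[R]_(m, n)) :
  mp_pinv B *m (B *m B^T) = B^T.
Proof.
have [B1 _ _ B4] := mp_pinvP B.
by rewrite mulmxA -B4 -trmx_mul mulmxA B1.
Qed.

Lemma negradB (R : realType) p n m (A : 'M[R]_(p, n)) u0 (W : 'M[R]_(m, n)) beta
    u v :
  negrad A u0 W beta v - negrad A u0 W beta u = - (hess A W beta *m (v - u)).
Proof. by rewrite /negrad mulmxBr !opprB addrC addrA subrK. Qed.

(** Stationarity is multiplied by B^+. Since B^+ B B^+ = B^+, the multiplier term becomes B^+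
    applied to the old negative gradient, which combines with the new one into a Hessian times v -
    u; the Gram identity isolates B^T v. *)
Lemma ustep_zero_rows (R : realType) p n m (A : 'M[R]_(p, n)) u0
    (W : 'M[R]_(m, n)) beta rho tk u y v :
  is_argmin (ustep_obj A u0 W beta rho tk u y) v ->
  (forall i, y i 0 != 0 -> y i 0 = (W *m u) i 0) ->
  let S := sel R (zero_set y) in let d := W *m (v - u) in
  rho *: ((cols (zero_set y) W^T)^T *m v) =
  - (mp_pinv (cols (zero_set y) W^T) *m (hess A W beta *m (v - u)
     + tk *: (v - u) + rho *: (W^T *m (d - S *m (S^T *m d))))).
Proof.
move=> vmin yw S d; set B := cols _ _; set X := mp_pinv B.
have BS : B = W^T *m S by rewrite /B colsE.
have [_ XBX _ _] := mp_pinvP B; set e := d - _.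
have := ustep_stationary vmin; rewrite (ustep_residual v yw) -/S -/d -/e zE.
have -> : W^T *m (multmx W (zero_set y) *m negrad A u0 W beta u) =
    B *m (X *m negrad A u0 W beta u) by rewrite /multmx -/B -/X BS !mulmxA.
have -> : W^T *m (S *m (S^T *m (W *m v)) + e) = B *m B^T *m v + W^T *m e.
  by rewrite BS trmx_mul trmxK mulmxDr !mulmxA.
have -> : hess A W beta *m (v - u) =
    negrad A u0 W beta u - negrad A u0 W beta v by rewrite -[RHS]opprB negradB opprK.
move: (negrad _ _ _ _ u) (negrad _ _ _ _ v) (v - u) (W^T *m e) => gu gv du We.
move=> /(congr1 (mulmx X)); rewrite mulmx0 !mulmxDr !mulmxN -!scalemxAr.
rewrite !mulmxDr (mulmxA B X gu) (mulmxA X _ gu) (mulmxA X B X) XBX.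
rewrite (mulmxA X _ v) mp_pinv_mul_gram scalerDr.
rewrite addrCA => /eqP; rewrite addr_eq0 => /eqP ->.
by rewrite [- _ + X *m gu]addrC.
Qed.

(** After division by rho, tk <= rho bounds the proximal coefficient by 1, and rho >= 1 absorbs the
    factor 1/rho of the Hessian term. *)
Lemma ustep_zero_rows_le (R : realType) p n m (A : 'M[R]_(p, n)) u0
    (W : 'M[R]_(m, n)) beta rho tk u y v :
  0 < tk -> tk <= rho -> 1 <= rho ->
  is_argmin (ustep_obj A u0 W beta rho tk u y) v ->
  (forall i, y i 0 != 0 -> y i 0 = (W *m u) i 0) ->
  norm2 ((cols (zero_set y) W^T)^T *m v) <=
  spectral_norm (mp_pinv (cols (zero_set y) W^T)) *
   (spectral_norm (hess A W beta) + 1 + spectral_norm (W^T *m W)) *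
   norm2 (v - u).
Proof.
move=> t0 tr r1 vmin yw; have r0 : 0 < rho by exact: lt_le_trans r1.
have := congr1 (@norm2 R _) (ustep_zero_rows vmin yw).
set B := cols _ _; set S := sel _ _; set d := v - u; set e := W *m d - _.
rewrite norm2Z norm2N gtr0_norm// => E.
rewrite -(ler_pM2l r0) E; apply: (le_trans (norm2_mulmx _ _)).
rewrite -mulrA [leRHS]mulrCA ler_wpM2l ?spectral_norm_ge0//.
(* The vector e is W d with the entries in the zero set erased. *)
have eW : norm2 e <= norm2 (W *m d).
  apply: norm2_le_coord => i; rewrite submxE sel_selT.
  by case: ifP => _; rewrite ?subrr ?normr0// subr0.
apply: (le_trans (norm2D _ _)).
have le1 := norm2D (hess A W beta *m d) (tk *: d).
have le2 := norm2_mulmx (hess A W beta) d.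
have le3 : norm2 (W^T *m e) <= spectral_norm (W^T *m W) * norm2 d.
  exact: norm2_tr_mulmx_le.
rewrite !norm2Z !gtr0_norm// in le1 *.
have H0 := spectral_norm_ge0 (hess A W beta); have d0 := norm2_ge0 d.
have le4 := ler_wpM2l (ltW r0) le3.
have le5 : tk * norm2 d <= rho * norm2 d by rewrite ler_wpM2r.
have le6 : spectral_norm (hess A W beta) * norm2 d <=
    rho * (spectral_norm (hess A W beta) * norm2 d).
  by rewrite ler_peMl// mulr_ge0.
lra.
Qed.

(* The four-fold bound on t_k makes the drift of the multiplier cost at most
   half of the proximal decrease. *)
Lemma ustep_descent (R : realType) p n m (A : 'M[R]_(p, n)) u0
    (W : 'M[R]_(m, n)) lambda beta rho tk u y v :
  0 < tk -> tk <= rho -> 1 <= rho -> tbound A W beta (zero_set y) <= tk ->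
  is_argmin (ustep_obj A u0 W beta rho tk u y) v ->
  (forall i, y i 0 != 0 -> y i 0 = (W *m u) i 0) ->
  h A u0 W lambda beta rho v y + tk / 4 * norm2 (v - u) ^+ 2 <=
  h A u0 W lambda beta rho u y.
Proof.
move=> t0 tr r1 tb vmin yw.
have := ustep_zero_rows_le t0 tr r1 vmin yw.
have := vmin u; rewrite !ustep_objE subrr norm2_0 !hE.
rewrite (dotvDl _ (- y)) dotvNl (dotvDl _ (- y)) dotvNl.
rewrite {2 4}zE !dotv_zero_set.
move: tb; rewrite /tbound -/(hess _ _ _).
set B := cols _ _; set P := spectral_norm _; set H := spectral_norm (hess _ _ _).
set K := spectral_norm (_ *m _); set d := v - u => tb obj rows.
(* Only the rows of W v in the zero set meet the multiplier, so the drift is a product of two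
   quantities of order |d|. *)
have zz : `|dotv (W *m v) (z A u0 W beta v y - z A u0 W beta u y)| <=
    norm2 (B^T *m v) * (P * (H * norm2 d)).
  rewrite !zE -mulmxBr negradB mulmxN dotvNr normrN /multmx -mulmxA -dotv_tmull.
  have -> : (sel R (zero_set y))^T *m (W *m v) = B^T *m v.
    by rewrite /B colsE trmx_mul trmxK mulmxA.
  apply: (le_trans (dotv_le _ _)); rewrite ler_wpM2l ?norm2_ge0//.
  apply: (le_trans (norm2_mulmx _ _)).
  by rewrite ler_wpM2l ?spectral_norm_ge0// norm2_mulmx.
have := le_trans (ler_norm _) zz; rewrite dotvDr dotvNr.
have P0 : 0 <= P by exact: spectral_norm_ge0.
have H0 : 0 <= H by exact: spectral_norm_ge0.
have W0 : 0 <= spectral_norm W by exact: spectral_norm_ge0.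
have d0 := norm2_ge0 d.
have := ler_wpM2r (mulr_ge0 P0 (mulr_ge0 H0 d0)) rows.
have -> : P * (H + 1 + K) * norm2 d * (P * (H * norm2 d)) =
   (K * P ^+ 2 * H + (H + 1) * P ^+ 2 * H) * norm2 d ^+ 2 by ring.
(* The coefficient is at most a quarter of [tbound]; taken from the proximal tk/2 it leaves tk/4. *)
have : (K * P ^+ 2 * H + (H + 1) * P ^+ 2 * H) * norm2 d ^+ 2 <=
    tk / 4 * norm2 d ^+ 2.
  rewrite ler_wpM2r ?exprn_ge0//.
  have := mulr_ge0 (mulr_ge0 P0 W0) H0; lra.
lra.
Qed.

(** * The y-step *)

Lemma norm0E (R : realType) m (y : 'cV[R]_m) :
  (norm0 y)%:R = \sum_i (y i 0 != 0)%:R :> R.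
Proof.
rewrite /norm0 -sum1_card natr_sum big_mkcond; apply: eq_bigr => i _.
by rewrite inE; case: eqP.
Qed.

(** Moving one nonzero entry towards (W u)_i while keeping it nonzero preserves the zero set, hence
    z and the count; only the quadratic penalty changes. *)
Lemma ystep_agree (R : realType) p n m (A : 'M[R]_(p, n)) u0
    (W : 'M[R]_(m, n)) lambda beta rho u (y : 'cV[R]_m) :
  0 < rho -> is_argmin (h A u0 W lambda beta rho u) y ->
  forall i, y i 0 != 0 -> y i 0 = (W *m u) i 0.
Proof.
move=> r0 ymin i yi; set w := W *m u.
(* If (W u)_i = 0, moving all the way would create a zero, so the entry moves halfway. *)
pose s : R := if w i 0 == 0 then 2^-1 else 0.
pose yi' := w i 0 + s * (y i 0 - w i 0).
pose y' : 'cV[R]_m := \col_j if j == i then yi' else y j 0.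
have y'i : y' i 0 = yi' by rewrite mxE eqxx.
have y'j j : j != i -> y' j 0 = y j 0 by move=> ji; rewrite mxE (negPf ji).
have yi'0 : yi' != 0.
  rewrite /yi' /s; case: (eqVneq (w i 0)) => [->|wi]; last by rewrite mul0r addr0.
  by rewrite add0r subr0 mulf_neq0// invr_neq0.
have y'0 j : (y' j 0 == 0) = (y j 0 == 0).
  have [->|/y'j->//] := eqVneq j i.
  by rewrite y'i (negPf yi) (negPf yi'0).
have := ymin y'; rewrite !hE !zE.
have -> : zero_set y' = zero_set y by apply/setP => j; rewrite !inE y'0.
have -> : norm0 y' = norm0 y by apply: eq_card => j; rewrite !inE y'0.
rewrite lerD2l ler_pM2l ?divr_gt0// !norm2_sqr /dotv (bigD1 i)//=.
rewrite [leRHS](bigD1 i)//= [X in _ <= _ + X](eq_bigr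
  (fun j => (w - y) j 0 * (w - y) j 0)).
  rewrite lerD2r !submxE y'i /yi' /s => le; apply/eqP.
  rewrite -subr_eq0 -sqrf_eq0 eq_le sqr_ge0 andbT.
  by move: le; case: (eqVneq (w i 0)) => _; nra.
by move=> j ji; rewrite !submxE y'j.
Qed.

(** Share of coordinate i in [h] once the nonzero entries of y agree with W u, with v the negative
    gradient. It depends on the whole zero set through [multmx], so coordinates do not decouple and
    bounds uniform in that set are used. *)
Definition ycost (R : realType) n m (W : 'M[R]_(m, n)) (lambda rho : R)
    (v u : 'cV[R]_n) (y : 'cV[R]_m) (i : 'I_m) : R :=
  let w := (W *m u) i 0 in
  if y i 0 == 0 then w * (multmx W (zero_set y) *m v) i 0 + rho / 2 * w ^+ 2
  else lambda.

Lemma h_ycost (R : realType) p n m (A : 'M[R]_(p, n)) u0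
    (W : 'M[R]_(m, n)) lambda beta rho u (y : 'cV[R]_m) :
  (forall i, y i 0 != 0 -> y i 0 = (W *m u) i 0) ->
  h A u0 W lambda beta rho u y = energy A u0 W beta u
    + \sum_i ycost W lambda rho (negrad A u0 W beta u) u y i.
Proof.
move=> yw; rewrite hE; move: (energy _ _ _ _ _) => E.
rewrite -!addrA; congr (_ + _).
rewrite norm0E norm2_sqr /dotv !mulr_sumr -!big_split; apply: eq_bigr => i _ /=.
rewrite /ycost submxE zE; case: eqVneq => [->|yi].
  by rewrite mulr0 add0r subr0 expr2.
by rewrite multmx_notin ?inE// -yw// subrr !mulr0 mulr1 add0r addr0.
Qed.

(** Completing the square in rho x - M. *)
Lemma quad_lower (R : realType) (M rho l x : R) : 0 < rho ->
  M ^+ 2 <= rho * l -> - (l / 2) <= rho / 2 * x ^+ 2 - M * x.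
Proof.
move=> r0 Ml; rewrite -subr_ge0 -(pmulr_rge0 _ r0).
have -> : rho * (rho / 2 * x ^+ 2 - M * x - - (l / 2)) =
  ((rho * x - M) ^+ 2 + (rho * l - M ^+ 2)) / 2 by field.
by rewrite divr_ge0// addr_ge0 ?sqr_ge0 ?subr_ge0.
Qed.

(** The bound on x is the positive root of rho/2 x^2 + M x = l/2. *)
Lemma quad_upper (R : realType) (M rho l x : R) :
  0 <= M -> 0 < rho -> 0 <= l -> 0 <= x ->
  x <= (- M + Num.sqrt (M ^+ 2 + rho * l)) / rho ->
  rho / 2 * x ^+ 2 + M * x <= l / 2.
Proof.
move=> M0 r0 l0 x0; rewrite ler_pdivlMr// => xs.
rewrite -subr_ge0 -(pmulr_rge0 _ r0).
have s2 : (rho * x + M) ^+ 2 <= M ^+ 2 + rho * l.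
  rewrite -[leRHS]sqr_sqrtr ?addr_ge0 ?mulr_ge0 ?exprn_ge0 ?(ltW r0)//.
  by rewrite lerXn2r ?nnegrE ?addr_ge0 ?mulr_ge0 ?sqrtr_ge0 ?(ltW r0)//; lra.
nra.
Qed.

(** The bound on x is the larger root of rho/2 x^2 - M x = l. *)
Lemma quad_large (R : realType) (M rho l x : R) :
  0 <= M -> 0 < rho -> 0 <= l ->
  (M + Num.sqrt (M ^+ 2 + 2 * rho * l)) / rho <= x ->
  l <= rho / 2 * x ^+ 2 - M * x.
Proof.
move=> M0 r0 l0; rewrite ler_pdivrMr// => xs.
rewrite -subr_ge0 -(pmulr_rge0 _ r0).
have s2 : M ^+ 2 + 2 * rho * l <= (rho * x - M) ^+ 2.
  rewrite -[leLHS]sqr_sqrtr; last first.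
    by rewrite addr_ge0 ?mulr_ge0 ?exprn_ge0 ?(ltW r0).
  have := sqrtr_ge0 (M ^+ 2 + 2 * rho * l).
  by move=> s0; rewrite lerXn2r ?nnegrE//; lra.
nra.
Qed.

Lemma ler_sum_term (R : realType) m (F : 'I_m -> R) i :
  (forall j, 0 <= F j) -> F i <= \sum_j F j.
Proof. by move=> F0; rewrite (bigD1 i)//= lerDl sumr_ge0. Qed.

(* Comparing with y = W u rules out zeroing an entry above the gap; comparing
   with the hard thresholding of W u then rules out keeping one below it. *)
Lemma ystep_threshold (R : realType) p n m (A : 'M[R]_(p, n)) u0
    (W : 'M[R]_(m, n)) lambda beta rho M u (y : 'cV[R]_m) :
  0 < lambda -> 0 < rho -> 0 <= M -> m%:R * M ^+ 2 / lambda < rho ->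
  (forall C i, `|(multmx W C *m negrad A u0 W beta u) i 0| <= M) ->
  (forall i : 'I_m, `|(W *m u) i 0| \notin
       `](- M + Num.sqrt (M ^+ 2 + rho * lambda / m%:R)) / rho,
         (M + Num.sqrt (M ^+ 2 + 2 * rho * (m%:R + 1) * lambda)) / rho[) ->
  is_argmin (h A u0 W lambda beta rho u) y ->
  forall i, y i 0 != 0 ->
    (M + Num.sqrt (M ^+ 2 + 2 * rho * (m%:R + 1) * lambda)) / rho
      <= `|(W *m u) i 0|.
Proof.
move=> l0 r0 M0 Mr zM gap ymin i0 yi0.
have m0 : 0 < m%:R :> R by rewrite ltr0n (leq_ltn_trans _ (ltn_ord i0)).
set w := W *m u in gap *; set l := lambda / m%:R.
have ml : m%:R * l = lambda by rewrite /l mulrCA divff ?mulr1// gt_eqF.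
have lp : 0 < l by rewrite divr_gt0.
have Ml : M ^+ 2 <= rho * l.
  move: Mr; rewrite ltr_pdivrMr// -ml => Mr.
  rewrite -(ler_pM2l m0); lra.
rewrite -mulrA -mulrA -/l in gap *; move: gap.
set t1 := _ / rho; set t2 := _ / rho => gap.
have t1_ge0 : 0 <= t1.
  rewrite divr_ge0 ?(ltW r0)// addrC subr_ge0 -[leLHS]ger0_norm// -sqrtr_sqr.
  by rewrite ler_wsqrtr// lerDl mulr_ge0 ?ltW.
have gapP i : `|w i 0| <= t1 \/ t2 <= `|w i 0|.
  by have := gap i; rewrite in_itv/= negb_and -!leNgt => /orP.
set G := negrad A u0 W beta u in zM *.
have wz C i : - (M * `|w i 0|) <= w i 0 * (multmx W C *m G) i 0 <= M * `|w i 0|.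
  by rewrite -ler_norml normrM mulrC ler_wpM2r.
have w2 i : w i 0 ^+ 2 = `|w i 0| ^+ 2 by rewrite real_normK ?num_real.
pose c := ycost W lambda rho G u.
have c_lower (y1 : 'cV[R]_m) i : y1 i 0 = 0 ->
    rho / 2 * `|w i 0| ^+ 2 - M * `|w i 0| <= c y1 i.
  move=> y1i; rewrite /c /ycost y1i eqxx -/w w2.
  by have /andP[+ _] := wz (zero_set y1) i; lra.
have cy i : - (l / 2) <= c y i.
  have [yi|yi] := eqVneq (y i 0) 0.
    by apply: le_trans (c_lower _ _ yi); exact: quad_lower.
  by rewrite /c /ycost (negPf yi); lra.
have yw := ystep_agree r0 ymin.
have cmin (y1 : 'cV[R]_m) : (forall i, y1 i 0 != 0 -> y1 i 0 = w i 0) ->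
    \sum_i c y i <= \sum_i c y1 i.
  by move=> y1w; have := ymin y1; rewrite !h_ycost// lerD2l.
have sum_const (a : R) : \sum_(i < m) a = m%:R * a.
  by rewrite sumr_const card_ord mulr_natl.
(* A zero at i would cost at least (m+1) lambda, and the other coordinates save at most l/2 each;
   the total exceeds m lambda, which bounds the cost of y = W u. *)
have large i : t2 <= `|w i 0| -> y i 0 != 0.
  move=> wi; apply/negP => /eqP yi.
  have ci : (m%:R + 1) * lambda <= c y i.
    apply: le_trans (c_lower _ _ yi); apply: quad_large => //.
    by rewrite mulr_ge0 ?addr_ge0 ?ltW.
  have : \sum_i c y i <= \sum_(i < m) lambda.
    apply: (le_trans (cmin w (fun _ _ => erefl))); apply: ler_sum => j _.
    rewrite /c /ycost -/w; case: eqP => [->|//].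
    by rewrite expr0n/= !(mul0r, mulr0) addr0 ltW.
  have : c y i + l / 2 <= \sum_(j < m) (c y j + l / 2).
    by apply: (@ler_sum_term _ _ (fun j => c y j + l / 2)) => j; have := cy j; lra.
  rewrite big_split !sum_const/= mulrA ml; nra.
have [small|//] := gapP i0; exfalso.
(* Hard thresholding of W u at [t1]; each entry it erases costs at most l/2, against lambda for the
   nonzero entry at [i0]. *)
pose y1 : 'cV[R]_m := \col_i if `|w i 0| <= t1 then 0 else w i 0.
have y1E i : y1 i 0 = if `|w i 0| <= t1 then 0 else w i 0 by rewrite mxE.
have cy1 i : `|w i 0| <= t1 -> c y1 i <= l / 2.
  move=> wi; rewrite /c /ycost y1E wi eqxx -/w w2.
  have : rho / 2 * `|w i 0| ^+ 2 + M * `|w i 0| <= l / 2.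
    by apply: quad_upper => //; exact: ltW.
  by have /andP[_] := wz (zero_set y1) i; lra.
have diff i : 0 <= c y i - c y1 i + l.
  have [wi|wi] := lerP `|w i 0| t1; first by have := cy i; have := cy1 i wi; lra.
  have wi0 : w i 0 != 0 by rewrite -normr_gt0 (le_lt_trans t1_ge0).
  have yi : y i 0 != 0.
    by apply: large; case: (gapP i) => // /(lt_le_trans wi); rewrite ltxx.
  by rewrite /c /ycost y1E (lt_geF wi) (negPf yi) (negPf wi0); lra.
have : \sum_i c y i <= \sum_i c y1 i.
  by apply: cmin => i; rewrite y1E; case: ifP => // _; rewrite eqxx.
(* The nonnegative terms sum to at most m l = lambda, yet the one at [i0] is at least lambda +
   l/2. *)
have := @ler_sum_term _ _ (fun i => c y i - c y1 i + l) i0 diff.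
rewrite !big_split/= sum_const ml sumrN.
have := cy1 i0 small; have : c y i0 = lambda by rewrite /c /ycost (negPf yi0).
lra.
Qed.

(** * Regular subgradients of h *)

Lemma dotv0l (R : realType) n (x : 'cV[R]_n) : dotv 0 x = 0.
Proof. by rewrite dotvE trmx0 mul0mx mxE. Qed.

(** The topology comes from the maximum norm, whence the radius d/(N+1); the added 1 covers N =
    0. *)
Lemma near_norm2 (R : realType) N (x : 'cV[R]_N) (P : 'cV[R]_N -> Prop) d :
  0 < d -> (forall x', norm2 (x' - x) < d -> P x') -> \forall x' \near x, P x'.
Proof.
move=> d0 dP; apply/nbhs_normP.
have N0 : 0 < N%:R + 1 :> R by rewrite ltr_wpDl.
exists (d / (N%:R + 1)) => /=; first by rewrite divr_gt0.
move=> x' /=; rewrite distrC ltr_pdivlMr// => x'd; apply: dP.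
apply: (le_lt_trans (norm2_le_mxnorm _)); apply: le_lt_trans x'd.
by rewrite mulrC ler_wpM2l// lerDl.
Qed.

(** Epsilon form of the liminf condition. [limf_einf] is the opposite of a limsup, so it is enough
    to bound the supremum of the negated quotient by e on one punctured neighbourhood. *)
Lemma regular_subdiff_near (R : realType) N (g : 'cV[R]_N -> R) (x v : 'cV[R]_N) :
  (forall e, 0 < e -> \forall x' \near x,
     - (e * norm2 (x' - x)) <= g x' - g x - dotv v (x' - x)) ->
  regular_subdiff g x v.
Proof.
move=> gx; rewrite /regular_subdiff/= /limf_einf oppe_ge0.
apply/lee_addgt0Pr => e e0; rewrite add0e.
apply: ge_ereal_inf; exists (ereal_sup [set (- (((g x' - g x - dotv v (x' - x)) /
    norm2 (x' - x))%:E))%E | x' in [set x' | x' != x /\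
    - (e * norm2 (x' - x)) <= g x' - g x - dotv v (x' - x)]]).
  eexists; last reflexivity.
  by have := gx e e0; apply: filterS => x' /= H x'x; split.
apply: ge_ereal_sup => _ [x' [x'x H] <-]; rewrite -EFinN lee_fin.
have p0 : 0 < norm2 (x' - x).
  by rewrite ltNge; apply/negP => /norm2_le0/eqP; rewrite subr_eq0 (negPf x'x).
by rewrite lerNl ler_pdivlMr// mulNr.
Qed.

Lemma regular_critical (R : realType) N (g : 'cV[R]_N -> R) x :
  regular_subdiff g x 0 -> critical_point g x.
Proof.
move=> gx; exists (fun=> x), (fun=> 0); split=> //; exact: cvg_cst.
Qed.

Lemma norm2_subcol (R : realType) n m (d : 'cV[R]_(n + m)) :
  norm2 (usubmx d) <= norm2 d /\ norm2 (dsubmx d) <= norm2 d.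
Proof.
have dd : dotv d d = dotv (usubmx d) (usubmx d) + dotv (dsubmx d) (dsubmx d).
  rewrite /dotv big_split_ord/=; congr (_ + _); apply: eq_bigr => i _;
  by rewrite !mxE.
by split; apply: ler_wsqrtr; rewrite dd ?lerDl ?lerDr dotvv_ge0.
Qed.

Lemma nonzero_coord_gap (R : realType) m (y : 'cV[R]_m) :
  exists2 d, 0 < d & forall i, y i 0 != 0 -> d <= `|y i 0|.
Proof.
exists (\big[Num.min/1]_(i | y i 0 != 0) `|y i 0|).
  by apply: lt_bigmin => [|i]; rewrite ?ltr01 ?normr_gt0.
by move=> i yi; exact: bigmin_le_cond.
Qed.

(** Nonzero entries survive small perturbations, so zeros can only be lost nearby. *)
Lemma zero_set_near (R : realType) m (y : 'cV[R]_m) :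
  exists2 d, 0 < d &
    forall y', norm2 (y' - y) < d -> zero_set y' \subset zero_set y.
Proof.
have [d d0 dy] := nonzero_coord_gap y; exists d => // y' y'y.
apply/fintype.subsetP => i; rewrite !inE => /eqP y'i; apply/negPn/negP => /dy.
have := coord_le_norm2 (y' - y) i; rewrite submxE y'i sub0r normrN => le1 le2.
by have := lt_le_trans (le_lt_trans le1 y'y) le2; rewrite ltxx.
Qed.

Lemma norm0_zero_set (R : realType) m (y : 'cV[R]_m) :
  (norm0 y + #|zero_set y|)%N = m.
Proof.
rewrite -[RHS](card_ord m) -(cardsC (zero_set y)) addnC; congr (_ + _)%N.
by apply: eq_card => i; rewrite !inE.
Qed.

Lemma energy_tangent (R : realType) p n m (A : 'M[R]_(p, n)) u0
    (W : 'M[R]_(m, n)) beta u v :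
  0 <= beta ->
  energy A u0 W beta u - dotv (negrad A u0 W beta u) (v - u)
    <= energy A u0 W beta v.
Proof.
move=> b0; rewrite -{2}(subrK u v) (addrC _ u) energyD lerDl.
by rewrite mulr_ge0 ?invr_ge0// addr_ge0 ?mulr_ge0 ?dotvv_ge0.
Qed.

(* The nonsmoothness of h lies in the zero set of y: on the stratum of ys the
   first-order terms cancel and the error is quadratic, and on every other
   stratum near ys the counting term jumps up by at least lambda. *)
Lemma hjoint_critical (R : realType) p n m (A : 'M[R]_(p, n)) u0
    (W : 'M[R]_(m, n)) lambda beta rho (x : 'cV[R]_(n + m)) :
  0 < lambda -> 0 <= beta -> 0 <= rho ->
  let us := usubmx x in let ys := dsubmx x in
  let g := negrad A u0 W beta us in
  W *m us = ys -> W^T *m (multmx W (zero_set ys) *m g) = g ->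
  critical_point (hjoint A u0 W lambda beta rho) x.
Proof.
move=> l0 b0 r0 us ys g Wus Pg.
apply/regular_critical/regular_subdiff_near => e e0.
have [d0 d00 sub0] := zero_set_near ys.
set H := hess A W beta; set C := zero_set ys in Pg sub0 *.
(* [K] bounds the quadratic error on the stratum of [ys]. [K'] bounds the first-order variation on
   any stratum; summing over all index sets in [q] makes it uniform. *)
pose K := spectral_norm (W^T *m (multmx W C *m H)).
pose q := \sum_(D : {set 'I_m}) spectral_norm (multmx W D).
pose K' := norm2 g +
  (spectral_norm W + 1) * (q * (norm2 g + spectral_norm H)).
have K0 : 0 <= K by exact: spectral_norm_ge0.
have q0 : 0 <= q by apply: sumr_ge0 => D _; exact: spectral_norm_ge0.
have H0 := spectral_norm_ge0 H; have W0 := spectral_norm_ge0 W.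
have g0 := norm2_ge0 g.
have K'0 : 0 <= K' by rewrite addr_ge0// !mulr_ge0 ?addr_ge0.
(* The four radii ensure, in order: no new zeros, |du| <= 1, K r^2 <= e r, and K' r <= lambda. *)
have dpos :
    0 < Num.min d0 (Num.min 1 (Num.min (e / (K + 1)) (lambda / (K' + 1)))).
  by rewrite !lt_min d00 ltr01 !divr_gt0// ltr_wpDl.
apply: (near_norm2 dpos) => x'; rewrite !lt_min => /and4P[rd0 r1 rK rK'].
rewrite dotv0l subr0 /hjoint -/us -/ys.
set u := usubmx x'; set y := dsubmx x'; set r := norm2 _ in rd0 r1 rK rK' *.
have r_ge0 : 0 <= r by exact: norm2_ge0.
have [] := norm2_subcol (x' - x); rewrite !linearB/= -/u -/us -/y -/ys -/r.
set du := u - us; set dy := y - ys => dur dyr.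
have du0 := norm2_ge0 du.
have hE' v w : h A u0 W lambda beta rho v w = energy A u0 W beta v
    + dotv (W *m v - w) (z A u0 W beta v w) + lambda * (norm0 w)%:R
    + rho / 2 * norm2 (W *m v - w) ^+ 2 by rewrite /h /energy; ring.
rewrite !hE' Wus subrr norm2_0 dotv0l expr0n/= mulr0 !addr0.
have -> : W *m u - y = W *m du - dy.
  by rewrite /du /dy mulmxBr Wus opprB addrA subrK.
have -> : z A u0 W beta u y = multmx W (zero_set y) *m (g - H *m du).
  by rewrite zE /H /du -(negradB A u0) addrC subrK.
have En := energy_tangent A u0 W us u b0; rewrite -/g -/du in En. clearbody g.
have rr : 0 <= rho / 2 * norm2 (W *m du - dy) ^+ 2.
  by rewrite mulr_ge0 ?exprn_ge0 ?norm2_ge0 ?divr_ge0.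
have := sub0 y (le_lt_trans dyr rd0); rewrite subEproper => /orP[/eqP yC|yC].
  have -> : (norm0 y)%:R = (norm0 ys)%:R :> R.
    have := norm0_zero_set y; rewrite -[in RHS](norm0_zero_set ys) yC.
    by move=> /addIn ->.
  (* On the same stratum y and [ys] are both orthogonal to the range of the multiplier matrix, so
     only du enters the cross term. *)
  have dyQ v : dotv dy (multmx W (zero_set y) *m v) = 0.
    by rewrite dotvDl dotvNl dotv_zero_set yC dotv_zero_set subrr.
  have cross v : dotv (W *m du - dy) (multmx W (zero_set y) *m v) =
      dotv du (W^T *m (multmx W C *m v)).
    by rewrite dotvDl dotvNl dyQ subr0 dotv_mull yC.
  (* By [Pg] the term <g, du> cancels the linear term of the energy. *)
  rewrite cross 2!mulmxBr Pg (dotvDr g) dotvNr (dotvC du g).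
  rewrite (mulmxA (multmx W C)) (mulmxA W^T _ du).
  set k := dotv du _; have kK : k <= K * r * r.
    apply: (le_trans (ler_norm _)); apply: (le_trans (dotv_le _ _)).
    rewrite mulrC; apply: ler_pM; rewrite ?norm2_ge0//.
    apply: (le_trans (norm2_mulmx _ _)); exact: ler_wpM2l.
  have : K * r * r <= e * r.
    by rewrite ler_wpM2r//; move: rK; rewrite ltr_pdivlMr ?ltr_wpDl//; lra.
  lra.
(* A strictly smaller zero set raises the count by at least one. *)
have card1 : (norm0 ys)%:R + 1 <= (norm0 y)%:R :> R.
  rewrite natr1 ler_nat -(ltn_add2r #|C|) norm0_zero_set.
  by rewrite -[X in (X < _)%N](norm0_zero_set y) ltn_add2l proper_card.
have card_lambda := ler_wpM2l (ltW l0) card1.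
have gdu : dotv g du <= norm2 g * r.
  apply: (le_trans (ler_norm _)); apply: (le_trans (dotv_le _ _)).
  by rewrite ler_wpM2l.
set k := dotv (W *m du - dy) _.
have kK : `|k| <= (spectral_norm W + 1) * r * (q * (norm2 g + spectral_norm H)).
  apply: (le_trans (dotv_le _ _)); apply: ler_pM; rewrite ?norm2_ge0//.
    apply: (le_trans (norm2B _ _)); have := norm2_mulmx W du.
    by have := ler_wpM2l W0 dur; lra.
  apply: (le_trans (norm2_mulmx _ _)).
  apply: ler_pM; rewrite ?norm2_ge0 ?spectral_norm_ge0//.
    by rewrite /q (bigD1 (zero_set y))//= lerDl sumr_ge0// => D _;
      exact: spectral_norm_ge0.
  apply: (le_trans (norm2B _ _)); rewrite lerD2l.
  apply: (le_trans (norm2_mulmx _ _)).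
  by rewrite ler_piMr// (le_trans dur)// ltW.
have kl : K' * r <= lambda.
  by move: rK'; rewrite ltr_pdivlMr ?ltr_wpDl//; lra.
have : K' * r = norm2 g * r +
    (spectral_norm W + 1) * r * (q * (norm2 g + spectral_norm H)).
  by rewrite /K'; ring.
have := mulr_ge0 (ltW e0) r_ge0.
have := ler_norm (- k); rewrite normrN; lra.
Qed.

(** * Convergence of the increments *)

Lemma cluster_seq (R : realType) N (X : nat -> 'cV[R]_N) x (P : nat -> Prop) e :
  cluster (X k @[k --> \oo]) x -> (\forall k \near \oo, P k) -> 0 < e ->
  exists2 k, P k & norm2 (X k - x) < e.
Proof.
move=> Xx NP e0.
have [] := Xx [set x' | exists2 k, P k & X k = x'] [set x' | norm2 (x' - x) < e].
- by apply: filterS NP => k Pk; exists k.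
- exact: near_norm2 e0 _.
- by move=> _ [[k Pk <-] Xe]; exists k.
Qed.

(** The monotone bounded sequence a converges, so its successive differences, which dominate b
    d_k^2, tend to 0. *)
Lemma sufficient_decrease (R : realType) (a d : nat -> R) (b lb : R) :
  0 < b -> (forall k, 0 <= d k) -> (forall k, lb <= a k) ->
  (forall k, a k.+1 + b * d k ^+ 2 <= a k) ->
  forall e, 0 < e -> \forall k \near \oo, d k < e.
Proof.
move=> b0 d0 alb dec e e0.
have noninc : {homo a : k l / (k <= l)%N >-> l <= k}.
  apply/nonincreasing_seqP => k; apply: le_trans (dec k).
  by rewrite lerDl mulr_ge0 ?exprn_ge0 ?d0 ?ltW.
have ca : cvgn a.
  by apply: nonincreasing_is_cvgn => //; exists lb => _ [k _ <-]; exact: alb.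

have : (fun k => a k - a k.+1) @ \oo --> (0 : R).
  rewrite -(subrr (limn a)); apply: cvgB => //.
  by rewrite cvg_shiftS.
move=> /cvgrPdist_lt/(_ (b * e ^+ 2)) => /(_ (mulr_gt0 b0 (exprn_gt0 2 e0))).
apply: filterS => k; rewrite sub0r normrN => H.
have := le_lt_trans (ler_norm _) H => {}H.
rewrite ltNge; apply/negP => ed; move: H; apply/negP; rewrite -leNgt.
have : b * e ^+ 2 <= b * d k ^+ 2.
  by rewrite ler_pM2l// lerXn2r ?nnegrE// ltW.
by have := dec k; lra.
Qed.

Lemma ler_eps (R : realType) (a K e0 : R) :
  0 <= K -> 0 < e0 -> (forall e, 0 < e -> e <= e0 -> a <= K * e) -> a <= 0.
Proof.
move=> K0 e00 aK; apply/ler_addgt0Pr => e egt0; rewrite add0r.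
have K1 : 0 < K + 1 by rewrite ltr_wpDl.
apply: (le_trans (aK (Num.min e0 (e / (K + 1))) _ _)).
- by rewrite lt_min e00 divr_gt0.
- by rewrite ge_min lexx.
apply: (@le_trans _ _ (K * (e / (K + 1)))).
  by rewrite ler_wpM2l// ge_min lexx orbT.
rewrite mulrA ler_pdivrMr//; nra.
Qed.

(** * Uniform bounds along the iterates *)

Lemma Mconst_ub (R : realType) p n m (A : 'M[R]_(p, n)) u0 (W : 'M[R]_(m, n))
    beta (u : nat -> 'cV[R]_n) (b : R) :
  (forall k, norm2 (u k) <= b) ->
  forall C k, (0 < k)%N -> `|zC A u0 W beta C (u k)| <= Mconst A u0 W beta u.
Proof.
move=> ub C k k0; apply: ub_le_sup; last by exists C => //; exists k.
(* Boundedness of the iterates and finiteness of the family of index sets make the supremum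
   genuine. *)
pose q := \sum_(D : {set 'I_m}) spectral_norm (mp_pinv (cols D W^T)).
exists (q * (norm2 (A^T *m u0) + spectral_norm (hess A W beta) * b)).
move=> _ [D _ [l _ <-]]; rewrite zCE.
apply: (le_trans (mxnorm_le_norm2 _)); apply: (le_trans (norm2_mulmx _ _)).
apply: ler_pM; rewrite ?norm2_ge0 ?spectral_norm_ge0//.
  by rewrite /q (bigD1 D)//= lerDl sumr_ge0// => E _; exact: spectral_norm_ge0.
apply: (le_trans (norm2B _ _)); rewrite lerD2l.
apply: (le_trans (norm2_mulmx _ _)); rewrite ler_wpM2l ?spectral_norm_ge0//.
Qed.

(** The energy is nonnegative, and [quad_lower] with l = M^2/rho bounds each coordinate cost
    below. *)
Lemma h_lower (R : realType) p n m (A : 'M[R]_(p, n)) u0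
    (W : 'M[R]_(m, n)) lambda beta rho M u (y : 'cV[R]_m) :
  0 <= lambda -> 0 <= beta -> 0 < rho ->
  (forall i, `|(multmx W (zero_set y) *m negrad A u0 W beta u) i 0| <= M) ->
  (forall i, y i 0 != 0 -> y i 0 = (W *m u) i 0) ->
  - (m%:R * (M ^+ 2 / rho / 2)) <= h A u0 W lambda beta rho u y.
Proof.
move=> l0 b0 r0 zM yw; rewrite h_ycost//.
have E0 : 0 <= energy A u0 W beta u.
  by rewrite addr_ge0 ?mulr_ge0 ?exprn_ge0 ?norm2_ge0 ?invr_ge0.
apply: ler_wpDl => //.
have -> : - (m%:R * (M ^+ 2 / rho / 2)) = \sum_(i < m) - (M ^+ 2 / rho / 2).
  by rewrite sumr_const card_ord mulNrn mulr_natl.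
apply: ler_sum => i _; rewrite /ycost; case: eqP => yi; last first.
  by apply: le_trans l0; rewrite oppr_le0 !divr_ge0 ?sqr_ge0 ?(ltW r0).
set w := (W *m u) i 0; have := zM i; set zi := (_ *m _) i 0 => ziM.
have M0 : 0 <= M by exact: le_trans ziM.
have : - (M * `|w|) <= w * zi.
  by have : `|w * zi| <= M * `|w|;
    [rewrite normrM mulrC ler_wpM2r | rewrite ler_norml => /andP[]].
have : - (M ^+ 2 / rho / 2) <= rho / 2 * `|w| ^+ 2 - M * `|w|.
  apply: quad_lower => //; rewrite ?divr_ge0 ?sqr_ge0 ?(ltW r0)//.
  by rewrite mulrCA divff ?mulr1// gt_eqF.
rewrite real_normK ?num_real//; lra.
Qed.

(** The constant is chosen from C before the step, so it serves all iterates with that zero set. *)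
Lemma ustep_residual_le (R : realType) p n m (A : 'M[R]_(p, n)) u0
    (W : 'M[R]_(m, n)) beta rho (C : {set 'I_m}) :
  1 <= rho ->
  exists2 K, 0 <= K & forall tk u y v, zero_set y = C -> 0 < tk -> tk <= rho ->
  is_argmin (ustep_obj A u0 W beta rho tk u y) v ->
  (forall i, y i 0 != 0 -> y i 0 = (W *m u) i 0) ->
  norm2 (W *m v - y) <= K * norm2 (v - u).
Proof.
move=> r1; set P := spectral_norm (mp_pinv (cols C W^T)).
set H := spectral_norm (hess A W beta) + 1 + spectral_norm (W^T *m W).
exists (spectral_norm (sel R C) * (P * H) + spectral_norm W).
  by rewrite addr_ge0 ?mulr_ge0 ?addr_ge0 ?spectral_norm_ge0.
move=> tk u y v yC t0 tr vmin yw.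
have rows := ustep_zero_rows_le t0 tr r1 vmin yw.
rewrite (ustep_residual v yw) mulrDl; move: rows; rewrite yC -/P -/H => rows.
apply: (le_trans (norm2D _ _)); apply: lerD.
  apply: (le_trans (norm2_mulmx _ _)); rewrite -mulrA.
  rewrite ler_wpM2l ?spectral_norm_ge0//; apply: le_trans rows.
  by rewrite colsE trmx_mul trmxK mulmxA.
apply: le_trans (norm2_mulmx _ _); apply: norm2_le_coord => i.
rewrite submxE sel_selT.
by case: ifP => _; rewrite ?subrr ?normr0// subr0.
Qed.

Theorem theorem3p16 (R : realType) (p n m : nat)
  (A : 'M[R]_(p, n)) (u0 : 'cV[R]_p) (W : 'M[R]_(m, n))
  (lambda beta rho : R) (tk : nat -> R)
  (u : nat -> 'cV[R]_n) (y : nat -> 'cV[R]_m) (t c : R)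
  (lambda_gt0 : 0 < lambda) (beta_gt0 : 0 < beta) (rho_gt0 : 0 < rho)
  (tk_gt0 : forall k, 0 < tk k)
  (algB : algorithmB A u0 W lambda beta rho tk u y)
  (bnd : [bounded col_mx (u k) (y k) | k in [set: nat]]) :
  let M := Mconst A u0 W beta u in
  m%:R * M ^+ 2 / lambda < rho ->
  (\forall k \near \oo, forall i : 'I_m,
     `|(W *m u k) i 0| \notin
       `](- M + Num.sqrt (M ^+ 2 + rho * lambda / m%:R)) / rho,
         (M + Num.sqrt (M ^+ 2 + 2 * rho * (m%:R + 1) * lambda)) / rho[) ->
  (exists k, tk k = t) -> (forall k, tk k <= t) ->
  Num.max t 1 <= rho ->
  0 < c ->
  (forall k j, Num.max (tbound A W beta (zero_set (y j))) c <= tk k) ->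
  forall x : 'cV[R]_(n + m),
    cluster (col_mx (u k) (y k) @[k --> \oo]) x ->
    critical_point (hjoint A u0 W lambda beta rho) x.
Proof.
move=> M Mrho gap _ tkt; rewrite ge_max => /andP[trho rho1] c0 tkb x Xx.
have [y0 umin ymin] := algB.
have tkrho k : tk k <= rho by exact: le_trans trho.
have tkb1 k : tbound A W beta (zero_set (y k)) <= tk k.
  by apply: le_trans (tkb k k); rewrite le_max lexx.
have tkc k : c <= tk k by apply: le_trans (tkb k k); rewrite le_max lexx orbT.
have yw k i : y k i 0 != 0 -> y k i 0 = (W *m u k) i 0.
  by case: k => [_|k]; [rewrite y0|exact: ystep_agree (ymin k) i].
have [b ub] : exists b, forall k, norm2 (u k) <= b.
  have [b [_ bP]] := bnd; exists ((n + m)%:R * (b + 1)) => k.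
  have [+ _] := norm2_subcol (col_mx (u k) (y k)); rewrite col_mxKu => le1.
  apply: (le_trans le1); apply: (le_trans (norm2_le_mxnorm _)).
  by rewrite ler_wpM2l//; apply: bP => //; rewrite ltrDl.
have Mub C k : (0 < k)%N -> `|zC A u0 W beta C (u k)| <= M.
  exact: Mconst_ub ub C k.
have M0 : 0 <= M by apply: le_trans (Mub finset.set0 1%N isT).
have zM k C i : (0 < k)%N ->
    `|(multmx W C *m negrad A u0 W beta (u k)) i 0| <= M.
  move=> k0; apply: le_trans (Mub C k k0); rewrite zCE; exact: multmx_le.
pose a k := h A u0 W lambda beta rho (u k) (y k).
pose d k := norm2 (u k.+1 - u k).
have dec k : a k.+1 + c / 4 * d k ^+ 2 <= a k.
  apply: le_trans (ustep_descent lambda (tk_gt0 k) (tkrho k) rho1 (tkb1 k)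
    (umin k) (yw k)).
  rewrite lerD ?ymin//.
  by rewrite ler_wpM2r ?exprn_ge0 ?norm2_ge0// ler_wpM2r ?invr_ge0.
have alb k : - (m%:R * (M ^+ 2 / rho / 2)) <= a k.
  (* M controls only the iterates with k >= 1; the index 0 follows from a 1 <= a 0. *)
  have lbS j : - (m%:R * (M ^+ 2 / rho / 2)) <= a j.+1.
    by apply: h_lower => //; [exact: ltW|exact: ltW|move=> i; exact: zM|exact: yw].
  case: k => //; apply: (le_trans (lbS 0%N)); apply: le_trans (dec 0%N).
  by rewrite lerDl mulr_ge0 ?exprn_ge0 ?norm2_ge0 ?divr_ge0 ?ltW.
have d_to0 e : 0 < e -> \forall k \near \oo, d k < e.
  apply: (sufficient_decrease _ (fun k => norm2_ge0 _) alb dec).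
  by rewrite divr_gt0.
pose t2 := (M + Num.sqrt (M ^+ 2 + 2 * rho * (m%:R + 1) * lambda)) / rho.
have yminS k : (0 < k)%N -> is_argmin (h A u0 W lambda beta rho (u k)) (y k).
  by case: k => // k _; exact: ymin.
have thr : \forall k \near \oo, forall i, y k i 0 != 0 -> t2 <= `|y k i 0|.
  near=> k => i yi; rewrite yw//; move: i yi.
  have k0 : (0 < k)%N by near: k; exact: nbhs_infty_gt.
  apply: (ystep_threshold lambda_gt0 rho_gt0 M0 Mrho _ _ (yminS k k0)).
    by move=> C i; exact: zM.
  by near: k.
have t2_gt0 : 0 < t2.
  rewrite divr_gt0// ltr_wpDl// sqrtr_gt0.
  by rewrite ltr_wpDl ?exprn_ge0// !mulr_gt0// ltr_wpDl.
set us := usubmx x; set ys := dsubmx x; set C := zero_set ys.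
set g := negrad A u0 W beta us.
have [e0 e00 sub0] := zero_set_near ys.
have [K1 K10 res] := ustep_residual_le A u0 W beta C rho1.
pose H := hess A W beta; pose Q := multmx W C.
(* The factors 2 come from |u^{k+1} - us| <= 2e, the 1 from |y^k - ys| < e, and the lone rho from
   t_k <= rho. *)
pose K2 := K1 + spectral_norm W * 2 + 1.
pose K3 := spectral_norm H * 2 + spectral_norm (W^T *m (Q *m H)) + rho
  + rho * (spectral_norm W^T * K1).
(* A single late iterate within e of x, with increment below e, transfers its stationarity relation
   to x up to O(e). *)
have approx e : 0 < e -> e <= Num.min e0 t2 ->
    norm2 (W *m us - ys) <= K2 * e /\ norm2 (W^T *m (Q *m g) - g) <= K3 * e.
  move=> egt0; rewrite le_min => /andP[ee0 et2].
  have ev : \forall k \near \oo,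
      (forall i, y k i 0 != 0 -> t2 <= `|y k i 0|) /\ d k < e.
    near=> k; split; first by near: k.
    by near: k; exact: d_to0.
  have [k [thrk dk] Xk] := cluster_seq Xx ev egt0.
  have [uk yk] : norm2 (u k - us) <= norm2 (col_mx (u k) (y k) - x) /\
      norm2 (y k - ys) <= norm2 (col_mx (u k) (y k) - x).
    have := norm2_subcol (col_mx (u k) (y k) - x).
    by rewrite !linearB/= col_mxKu col_mxKd.
  have {}uk := le_trans uk (ltW Xk); have {}yk := le_lt_trans yk Xk.
  (* Zeros of y^k lie in C because e <= e0; conversely, an entry of y^k at a zero of [ys] is below e
     <= t2, hence zero by the threshold. *)
  have yC : zero_set (y k) = C.
    apply/eqP; rewrite finset.eqEsubset sub0 ?(lt_le_trans yk)//=.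
    apply/fintype.subsetP => i; rewrite !inE => /eqP ysi; apply/negPn/negP => /thrk.
    have := coord_le_norm2 (y k - ys) i; rewrite submxE ysi subr0 => le1 le2.
    have := le_lt_trans (le_trans le2 le1) yk.
    by rewrite ltNge et2.
  have resk := res _ _ _ _ yC (tk_gt0 k) (tkrho k) (umin k) (yw k).
  have {}resk : norm2 (W *m u k.+1 - y k) <= K1 * e.
    by apply: (le_trans resk); rewrite ler_wpM2l// ltW.
  have uk1 : norm2 (u k.+1 - us) <= 2 * e.
    have -> : u k.+1 - us = (u k.+1 - u k) + (u k - us) by rewrite addrA subrK.
    by apply: (le_trans (norm2D _ _)); move: dk; rewrite /d; lra.
  split.
    have -> : W *m us - ys = (W *m u k.+1 - y k) - W *m (u k.+1 - us) + (y k - ys).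
      by rewrite mulmxBr; apply/matrixP => i j; rewrite !(submxE, addmxE); ring.
    apply: (le_trans (norm2D _ _)); apply: le_trans (lerD (norm2B _ _) (lexx _)) _.
    have := norm2_mulmx W (u k.+1 - us).
    have := ler_wpM2l (spectral_norm_ge0 W) uk1.
    rewrite /K2; move: (ltW yk); lra.
  have stat := ustep_stationary (umin k); rewrite zE yC -/Q in stat.
  set r := W *m u k.+1 - y k in resk stat.
  have gE v : negrad A u0 W beta v = g - H *m (v - us).
    by rewrite /H -(negradB A u0) addrC subrK.
  rewrite !gE in stat; clearbody g.
  rewrite (mulmxBr Q) (mulmxBr W^T) (mulmxA Q) (mulmxA W^T (Q *m H)) in stat.
  (* Stationarity at step k, with both gradients expanded around [us]. *)
  have -> : W^T *m (Q *m g) - g = W^T *m (Q *m H) *m (u k - us)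
      - H *m (u k.+1 - us) - tk k *: (u k.+1 - u k) - rho *: (W^T *m r).
    apply/eqP; rewrite -subr_eq0 -[X in _ == X]stat !opprB.
    by apply/eqP/matrixP => i j; rewrite !(submxE, addmxE); ring.
  have le1 := le_trans (norm2_mulmx (W^T *m (Q *m H)) (u k - us))
    (ler_wpM2l (spectral_norm_ge0 _) uk).
  have le2 := le_trans (norm2_mulmx H (u k.+1 - us))
    (ler_wpM2l (spectral_norm_ge0 _) uk1).
  have le3 : norm2 (tk k *: (u k.+1 - u k)) <= rho * e.
    by rewrite norm2Z gtr0_norm// ler_pM ?norm2_ge0 ?tkrho ?(ltW (tk_gt0 k)) ?(ltW dk).
  have le4 : norm2 (rho *: (W^T *m r)) <= rho * (spectral_norm W^T * (K1 * e)).
    rewrite norm2Z gtr0_norm// ler_wpM2l ?(ltW rho_gt0)//.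
    exact: le_trans (norm2_mulmx _ _) (ler_wpM2l (spectral_norm_ge0 _) resk).
  have := norm2B (W^T *m (Q *m H) *m (u k - us)) (H *m (u k.+1 - us)).
  set v1 := _ - _; have := norm2B v1 (tk k *: (u k.+1 - u k)).
  set v2 := _ - _; have := norm2B v2 (rho *: (W^T *m r)).
  rewrite /K3; lra.
have min0 : 0 < Num.min e0 t2 by rewrite lt_min e00.
have sW := spectral_norm_ge0 W.
have K20 : 0 <= K2 by rewrite !addr_ge0 ?mulr_ge0.
have K30 : 0 <= K3.
  by rewrite !addr_ge0 ?mulr_ge0 ?spectral_norm_ge0 ?(ltW rho_gt0).
(* Both premises are equalities, obtained by letting e tend to 0 in [approx]. *)
apply: hjoint_critical => //; try exact: ltW.
  apply/eqP; rewrite -subr_eq0; apply/eqP/norm2_le0.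
  by apply: (ler_eps K20 min0) => e ep em; case: (approx e ep em).
apply/eqP; rewrite -subr_eq0; apply/eqP/norm2_le0.
by apply: (ler_eps K30 min0) => e ep em; case: (approx e ep em).
Unshelve. all: by end_near. Qed.
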